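(* The sequence $\bigl(Z_n^e(x,f,h,\alpha\,|\,p,q)\bigr)_{n\ge0}$ is coefficientwise-Hankel totally positive in the variables $\{x,f,h,\alpha,p,q\}$.
   Context: $\mathfrak{S}_N$ is the set of permutations $\sigma=\sigma_1\cdots\sigma_N$ of $[N]$. With the convention $\sigma_0=\sigma_{N+1}=0$, a letter $\sigma_i$ ($i\in[N]$) is a valley if $\sigma_{i-1}>\sigma_i<\sigma_{i+1}$ and a peak if $\sigma_{i-1}<\sigma_i>\sigma_{i+1}$; $\mathrm{Val}(\sigma)$, $\mathrm{Pk}(\sigma)$ are the sets of letters that are valleys, peaks. $\mathrm{des}(\sigma)=\#\{1\le i\le N-1:\sigma_i>\sigma_{i+1}\}$. $\mathrm{lmax}(\sigma)$ is the number of left-to-right maxima (letters larger than all letters to their left), and $\mathrm{lmaxpk}(\sigma)$ the number of left-to-right maxima that are peaks. For $\sigma\in\mathfrak{S}_N$, $\mathrm{D}(\sigma)=\sum_{i\in\mathrm{Pk}(\sigma)\setminus\{N\}}i-\sum_{j\in\mathrm{Val}(\sigma)}j$. $(31\!-\!2)(\sigma)$ is the number of pairs $i<j\le N$ with $\sigma_i>\sigma_j>\sigma_{i+1}$; $(2\!-\!31)(\sigma)$ is the number of pairs $i<j<N$ with $\sigma_{j+1}<\sigma_i<\sigma_j$. $\mathcal{Z}_N$ is the set of alternating permutations of $[N]$: those with $\sigma_1>\sigma_2<\sigma_3>\sigma_4<\cdots$. Define $$Z_n^e(x,f,h,\alpha\,|\,p,q)=\sum_{\sigma\in\mathcal{Z}_{2n}}x^{\mathrm{des}(\sigma)}f^{\mathrm{lmaxpk}(\sigma)}h^{\mathrm{D}(\sigma)+2n-\sigma_{2n}}\alpha^{\mathrm{lmax}(\sigma)}p^{(31-2)(\sigma)}q^{(2-31)(\sigma)},$$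 with $Z_0^e=1$ (empty permutation). A sequence $(a_n)_{n\ge0}$ of real polynomials in a set of variables $\mathbf{X}$ is coefficientwise-Hankel totally positive in $\mathbf{X}$ if every minor of the infinite Hankel matrix $(a_{i+j})_{i,j\ge0}$ is a polynomial in $\mathbf{X}$ with nonnegative coefficients. *)

(* Defs.v *)
From mathcomp Require Export all_boot all_order all_fingroup all_algebra.
From mathcomp Require Import zify.
From mathcomp.multinomials Require Export mpoly.

Set Implicit Arguments.
Unset Strict Implicit.
Unset Printing Implicit Defensive.

Import Order.TTheory GRing.Theory Num.Theory.

Local Open Scope nat_scope.

(* The letter of s at the 1-based position i, with values in {1, ..., N};
   positions 0 and i > N (in particular N + 1) hold 0, the boundary
   convention. *)
Definition letter (N : nat) (s : 'S_N) (i : nat) : nat :=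
  if i is j.+1 then
    if insub j is Some k then (s k).+1 else 0
  else 0.

Arguments letter N s i : simpl never.

(* Sets of letters are represented by duplicate-free sequences: the letters at
   the positions 1, ..., N are distinct (see letter_inj). *)
Definition Val (N : nat) (s : 'S_N) : seq nat :=
  [seq letter s i | i <- iota 1 N &
     (letter s i < letter s i.-1) && (letter s i < letter s i.+1)].

Definition Pk (N : nat) (s : 'S_N) : seq nat :=
  [seq letter s i | i <- iota 1 N &
     (letter s i.-1 < letter s i) && (letter s i.+1 < letter s i)].

Definition Lmax (N : nat) (s : 'S_N) : seq nat :=
  [seq letter s i | i <- iota 1 N &
     all (fun j => letter s j < letter s i) (iota 1 i.-1)].

Definition des (N : nat) (s : 'S_N) : nat :=
  count (fun i => letter s i.+1 < letter s i) (iota 1 N.-1).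

Definition lmax (N : nat) (s : 'S_N) : nat := size (Lmax s).

Definition lmaxpk (N : nat) (s : 'S_N) : nat :=
  size [seq v <- Lmax s | v \in Pk s].

Definition D (N : nat) (s : 'S_N) : int :=
  ((\sum_(v <- Pk s | v != N) v)%N%:Z - (\sum_(v <- Val s) v)%N%:Z)%R.

Definition pat_31_2 (N : nat) (s : 'S_N) : nat :=
  \sum_(1 <= j < N.+1) \sum_(1 <= i < j)
    (letter s i.+1 < letter s j < letter s i).

Definition pat_2_31 (N : nat) (s : 'S_N) : nat :=
  \sum_(1 <= j < N) \sum_(1 <= i < j)
    (letter s j.+1 < letter s i < letter s j).

Definition alternating (N : nat) (s : 'S_N) : bool :=
  all (fun i => if odd i then letter s i.+1 < letter s i
                else letter s i < letter s i.+1) (iota 1 N.-1).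

(* The exponent of h; on alternating permutations of even length it is
   nonnegative (see hexp_ge0), so that taking its absolute value in Ze below
   changes nothing. *)
Definition hexp (N : nat) (s : 'S_N) : int :=
  (D s + N%:Z - (letter s N)%:Z)%R.

(* Ze n evaluated at elements of a commutative ring; the polynomial itself is
   obtained by taking the variables of a polynomial ring. *)
Definition Ze (A : comNzRingType) (n : nat) (x f h alpha p q : A) : A :=
  (\sum_(s : 'S_(2 * n) | alternating s)
     x ^+ des s * f ^+ lmaxpk s * h ^+ `|hexp s|%N * alpha ^+ lmax s
     * p ^+ pat_31_2 s * q ^+ pat_2_31 s)%R.

Definition mpoly_coef_ge0 (R : realFieldType) (k : nat) (P : {mpoly R[k]}) :
  Prop := forall m : 'X_{1..k}, (0 <= P@_m)%R.

Definition coefwise_Hankel_TP (R : realFieldType) (k : nat)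
    (a : nat -> {mpoly R[k]}) : Prop :=
  forall (d : nat) (r c : 'I_d -> nat),
    {homo r : i j / i < j} -> {homo c : i j / i < j} ->
    mpoly_coef_ge0 (\det (\matrix_(i < d, j < d) a (r i + c j)%N))%R.

Lemma letterE N (s : 'S_N) i (ltiN : i < N) :
  letter s i.+1 = (s (Ordinal ltiN)).+1.
Proof. by rewrite /letter insubT. Qed.

Lemma letter_inj N (s : 'S_N) : {in iota 1 N &, injective (letter s)}.
Proof.
move=> i j; rewrite !mem_iota !add1n.
case: i j => [|i] [|j] //= lti ltj.
rewrite (letterE s (lti : i < N)) (letterE s (ltj : j < N)).
by move=> [] /val_inj /perm_inj [->].
Qed.

Lemma hexp_ge0 n (s : 'S_(2 * n)) : alternating s -> (0 <= hexp s)%R.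
Proof.
move=> alt_s; set N := 2 * n.
have altP i : 0 < i -> i < N -> if odd i then letter s i.+1 < letter s i
                                else letter s i < letter s i.+1.
  by move=> i0 iN; apply: (allP alt_s); rewrite mem_iota; lia.
have letN1 : letter s N.+1 = 0 by rewrite /letter insubN // -leqNgt.
have let0 i : 0 < i <= N -> 0 < letter s i.
  by case: i => //= i lti; rewrite (letterE s lti).
have uniqPk : uniq (Pk s).
  rewrite map_inj_in_uniq ?filter_uniq ?iota_uniq // => i j.
  by rewrite !mem_filter => /andP[_ +] /andP[_ +]; apply: letter_inj.
have PkN : \sum_(v <- Pk s) v <= \sum_(v <- Pk s | v != N) v + N.
  rewrite (bigID (fun v => v != N)) /= leq_add2l.
  rewrite (eq_bigr (fun=> N)); last by move=> v; rewrite negbK => /eqP.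
  rewrite big_const_seq iter_addn_0 -[leqRHS]muln1 leq_mul2l.
  rewrite (eq_count (a2 := pred1 N)); last by move=> v; rewrite /= negbK.
  by rewrite count_uniq_mem // leq_b1 orbT.
have PkO : \sum_(i <- iota 1 N | odd i) letter s i <= \sum_(v <- Pk s) v.
  rewrite big_map big_filter big_mkcond [leqRHS]big_mkcond /=.
  rewrite big_seq [leqRHS]big_seq; apply: leq_sum => i.
  rewrite mem_iota => i_in; case: ifP => // oi.
  have := altP i ltac:(lia) ltac:(lia); rewrite oi => ->; rewrite andbT.
  case: i oi i_in => [|[|i]] // oi i_in; first by rewrite let0 //; lia.
  have := altP i.+1 ltac:(lia) ltac:(lia).
  by rewrite ifF => [->|]; last by move: oi => /= /negPn; lia.
have ValE : \sum_(v <- Val s) v + letter s N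
            <= \sum_(i <- iota 1 N | ~~ odd i) letter s i.
  rewrite big_map big_filter -/N.
  have L0 : letter s 0 = 0 by [].
  move: (letter s) L0 letN1 altP => L L0 LN1 altP.
  have [->|N0] := posnP N; first by rewrite !big_nil L0.
  have EN : iota 1 N = iota 1 N.-1 ++ [:: N].
    by have := iotaD 1 N.-1 1; rewrite addn1 add1n prednK.
  rewrite EN !big_cat !big_cons !big_nil /= LN1 ltn0 andbF.
  have -> : odd N = false by rewrite /N oddM.
  rewrite !addn0 leq_add2r big_mkcond [leqRHS]big_mkcond /=.
  rewrite big_seq [leqRHS]big_seq; apply: leq_sum => i.
  rewrite mem_iota => i_in; case: (boolP (odd i)) => oi /=; last by case: ifP.
  by have := altP i ltac:(lia) ltac:(lia); rewrite oi => ?; rewrite ifF //; lia.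
have EO m : m <= n -> \sum_(i <- iota 1 (2 * m) | ~~ odd i) letter s i
                      <= \sum_(i <- iota 1 (2 * m) | odd i) letter s i.
  elim: m => [|m IHm] ltmn; first by rewrite !big_nil.
  rewrite mulnS addnC iotaD !big_cat /= !big_cons !big_nil.
  have -> : odd (1 + 2 * m) by lia.
  have -> /= : odd (1 + 2 * m).+1 = false by lia.
  rewrite !addn0 leq_add ?IHm //; first lia.
  have m_lt : 1 + 2 * m < N by rewrite /N; lia.
  have := altP (1 + 2 * m) isT m_lt.
  by rewrite ifT; [apply: ltnW | lia].
have le_s := leq_trans (leq_trans ValE (EO n (leqnn n))) (leq_trans PkO PkN).
rewrite /hexp /D -/N; move: le_s.
move: (letter s N) (\sum_(v <- Val s) v) (\sum_(v <- Pk s | v != N) v).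
by move=> l u v; lia.
Qed.

Lemma Ze0 (A : comNzRingType) (x f h alpha p q : A) :
  Ze 0 x f h alpha p q = 1%R.
Proof.
rewrite /Ze (bigD1 (1%g : 'S_(2 * 0))) //= big1 => [|s]; last first.
  by have -> : s = 1%g; [apply/permP => -[] | rewrite eqxx].
rewrite addr0 /lmaxpk /lmax /des /pat_31_2 /pat_2_31 /hexp /D /Pk /Val /Lmax.
by rewrite /letter /= !big_nil !expr0 !mulr1.
Qed.

(* Main.v *)
Require Import Defs.
From mathcomp Require Import zify ring.
Import GRing.Theory Num.Theory.
Local Open Scope ring_scope.

Set Implicit Arguments.
Unset Strict Implicit.
Unset Printing Implicit Defensive.

(** The generating function of [Ze] is a Stieltjes continued fraction with
    coefficientwise nonnegative coefficients, and the Hankel matrix of such a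
    fraction is totally positive.

    Continued fraction.  Cut an alternating permutation of even length into
    consecutive pairs (peak, lower letter) and insert its letters in increasing
    order.  What is present after k insertions is a word of pairs in which some
    peaks are still holes, to be filled by larger letters.  Letter k + 1 either
    opens a new pair, placed immediately before a hole or at the end, or fills
    one of the holes; so with n holes there are n + 1 choices in the first case
    and n in the second.  Conversely the last letter inserted can be removed in
    one way only, whence [mem_configs] and [configs_uniq].  A pair of adjacent
    letters in descent straddles the new letter exactly when its peak is a hole,
    so the choice of the i-th place multiplies the weight by p^i q^(n-i), in the
    second case by p^i q^(n-1-i); a filled hole is a left-to-right maximum
    exactly when it is the first hole; and each insertion adds to the exponent
    of h the number of holes already present.  Summing over the choices
    ([sum_children]), the total weight of the words with k letters and m holes
    obeys the recursion of weighted walks on the natural numbers that start at 0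
    ([total_walk]), and the alternating permutations are the words without holes
    ([Ze_walk]): Ze n counts the walks of length 2n from 0 to 0, with step
    weights [up] and [down] that have nonnegative coefficients.

    Total positivity.  A row operation that replaces row i by a nonnegative
    combination of rows l i <= g i, where g i <= l i' for i < i', preserves the
    nonnegativity of all minors ([TP_row_op]): expanding a minor by
    multilinearity leaves minors of the old matrix and determinants with two
    equal rows.  One step of a walk is such an operation once the parity of the
    height is taken into account.  Thus the matrix of the walks of length 2i
    from 0 to 2l is totally positive ([walk_TP]), and so is the Hankel matrix,
    which is reached from it by extending the walks back to 0
    ([walk_Hankel_TP]). *)

(** * Total positivity of the Hankel matrix of weighted walks *)

Section TotalPositivity.
Variables (A : comNzRingType) (S : A -> Prop).
Hypotheses (S0 : S 0) (S1 : S 1).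
Hypothesis SD : forall a b, S a -> S b -> S (a + b).
Hypothesis SM : forall a b, S a -> S b -> S (a * b).

Definition minor (M : nat -> nat -> A) d (r c : 'I_d -> nat) : A :=
  \det (\matrix_(i < d, j < d) M (r i) (c j)).

(** The bound on the columns makes an induction on the number of columns
    possible; total positivity is the conjunction over all m. *)
Definition TP_upto (m : nat) (M : nat -> nat -> A) : Prop :=
  forall d (r c : 'I_d -> nat),
    {homo r : i j / (i < j)%N} -> {homo c : i j / (i < j)%N} ->
    (forall j, c j < m)%N -> S (minor M r c).

(** By multilinearity a minor of M' is a nonnegative combination of determinants
    whose i-th row is row l (r i) or row g (r i) of M.  The condition on l and g
    makes the selected indices weakly increasing: such a determinant is a minor
    of M, or vanishes because a row is repeated. *)
Lemma TP_row_op m M M' (a b : nat -> A) (l g : nat -> nat) :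
    (forall i, S (a i)) -> (forall i, S (b i)) ->
    (forall i, l i <= g i)%N -> (forall i i', i < i' -> g i <= l i')%N ->
    (forall i j, (j < m)%N -> M' i j = a i * M (l i) j + b i * M (g i) j) ->
  TP_upto m M -> TP_upto m M'.
Proof.
move=> Sa Sb lg gl M'E MTP d r c hr hc cm.
(* Rows are expanded one at a time: rows below t are still rows of M'. *)
pose Mix t (e : 'I_d -> nat) : 'M[A]_d :=
  \matrix_(i < d, j < d) if (i < t)%N then M' (r i) (c j) else M (e i) (c j).
suff SMix t (e : 'I_d -> nat) : (t <= d)%N ->
    (forall i : 'I_d, (t <= i)%N -> e i = l (r i) \/ e i = g (r i)) ->
    S (\det (Mix t e)).
  rewrite /minor (_ : \matrix_(i, j) _ = Mix d (fun=> 0%N)).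
    by apply: SMix => // i; rewrite leqNgt ltn_ord.
  by apply/matrixP=> i j; rewrite !mxE ltn_ord.
elim: t e => [|t IHt] e td lge.
  have e_le (i i' : 'I_d) : (i < i' -> e i <= e i')%N.
    move=> ii'; have := gl _ _ (hr _ _ ii').
    by have := lg (r i); have := lg (r i'); case: (lge i) => // ->;
       case: (lge i') => // ->; lia.
  have [e_inj|] := boolP (injectiveb e).
    apply: (MTP d e c) => // i i' ii'.
    rewrite ltn_neqAle e_le // andbT; apply/eqP => /(injectiveP _ e_inj) Eii'.
    by rewrite Eii' ltnn in ii'.
  case/injectivePn => i [i' ii' Eii'].
  by rewrite (determinant_alternate ii') // => j; rewrite !mxE /= Eii'.
pose k := Ordinal td.
have liftN i : lift k i != k by rewrite eq_sym neq_lift.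
have liftE i : (lift k i < t.+1)%N = (lift k i < t)%N.
  by rewrite ltnS leq_eqVlt (negPf (liftN i : lift k i != t :> nat)).
pose sel (v : nat) (i : 'I_d) := if i == k then v else e i.
have -> : \det (Mix t.+1 e) = a (r k) * \det (Mix t (sel (l (r k))))
                           + b (r k) * \det (Mix t (sel (g (r k)))).
  apply: (determinant_multilinear (i0 := k)).
  - by apply/rowP=> j; rewrite !mxE /= ltnSn ltnn /sel eqxx M'E.
  - by apply/matrixP=> i j; rewrite !mxE liftE /sel (negPf (liftN i)).
  - by apply/matrixP=> i j; rewrite !mxE liftE /sel (negPf (liftN i)).
have sel_ok v : v = l (r k) \/ v = g (r k) -> forall i : 'I_d, (t <= i)%N ->
    sel v i = l (r i) \/ sel v i = g (r i).
  move=> vk i ti; rewrite /sel; case: eqP => [->//|/eqP ik]; apply: lge.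
  by rewrite ltn_neqAle ti andbT eq_sym.
by apply: SD; apply: SM => //; apply: IHt; try exact: ltnW; apply: sel_ok; auto.
Qed.

(** The bound in [TP_upto] falls on the other index after transposition, which
    is why all bounds are needed in the hypothesis. *)
Lemma TP_tr M :
  (forall m, TP_upto m M) -> forall m, TP_upto m (fun i j => M j i).
Proof.
move=> MTP m d r c hr hc _; rewrite /minor -det_tr.
rewrite (_ : _^T = \matrix_(i < d, j < d) M (c i) (r j)); last first.
  by apply/matrixP=> i j; rewrite !mxE.
apply: (MTP (\max_(j < d) (r j).+1)) => // j.
exact: (leq_bigmax (F := fun j => (r j).+1) j).
Qed.

Variables (u d : nat -> A).
Hypotheses (Su : forall m, S (u m)) (Sd : forall m, S (d m)).

(** Walks of length k from 0 to m: a step from m to m + 1 weighs u m, one from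
    m + 1 to m weighs d m. *)
Fixpoint walk (k m : nat) : A :=
  if k isn't k'.+1 then (m == 0)%:R
  else (if m isn't m'.+1 then 0 else u m' * walk k' m') + d m * walk k' m.+1.

(** A minor that involves the new column either vanishes in that column or, by
    expansion along it, equals a smaller minor of M. *)
Lemma TP_cons0 m (M M' : nat -> nat -> A) :
    (forall i, M' i 0%N = (i == 0%N)%:R) ->
    (forall i j, M' i j.+1 = M i j) ->
  TP_upto m M -> TP_upto m.+1 M'.
Proof.
move=> M'0 M'S MTP [|n] r c hr hc cm; first by rewrite /minor det_mx00.
have c_gt0 (i : 'I_n.+1) : (0 < i)%N -> (0 < c i)%N.
  by move=> i0; apply: leq_trans (hc ord0 _ i0).
have r_gt0 (i : 'I_n.+1) : (0 < i)%N -> (0 < r i)%N.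
  by move=> i0; apply: leq_trans (hr ord0 _ i0).
have SMd n' (r' c' : 'I_n' -> nat) :
    {homo r' : i j / (i < j)%N} -> {homo c' : i j / (i < j)%N} ->
    (forall j, 0 < c' j <= m)%N -> S (minor M' r' c').
  move=> hr' hc' c'm; rewrite /minor.
  rewrite (_ : \matrix_(i, j) _ = \matrix_(i, j) M (r' i) (c' j).-1); last first.
    apply/matrixP=> i j; rewrite !mxE; have := c'm j.
    by case: (c' j) => [//|k] _; rewrite M'S.
  apply: (MTP n' r' (fun j => (c' j).-1)) => // [i j ij|j].
    by have := c'm i; have := hc' _ _ ij; lia.
  by have := c'm j; lia.
have [c0|c0] := posnP (c ord0); last first.
  apply: SMd => // j; have := cm j; rewrite ltnS => ->; rewrite andbT.
  by have [j0|/c_gt0//] := posnP j; rewrite (_ : j = ord0) //; apply: val_inj.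
rewrite /minor (expand_det_col _ ord0) big_ord_recl big1 => [|i _]; last first.
  rewrite !mxE c0 M'0; have := r_gt0 (lift ord0 i) isT.
  by case: (r _) => // k _; rewrite mul0r.
rewrite addr0 !mxE c0 M'0; case: eqP => _; last by rewrite mul0r.
rewrite mul1r /cofactor expr0 mul1r.
rewrite (_ : row' _ _ = \matrix_(i, j) M' (r (lift ord0 i)) (c (lift ord0 j))).
  apply: (SMd n (fun i => r (lift ord0 i)) (fun i => c (lift ord0 i))).
  - by move=> i j ij; apply: hr.
  - by move=> i j ij; apply: hc.
  - by move=> j; have := cm (lift ord0 j); rewrite ltnS => ->; rewrite c_gt0.
by apply/matrixP=> i j; rewrite !mxE.
Qed.

(** Lengthening all walks by two steps shifts the columns by one; the column of
    the empty walk is then put in front.  Each of the two steps is an operation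
    that combines two adjacent rows. *)
Lemma walk_TP m : TP_upto m (fun l i => walk (2 * i) (2 * l)).
Proof.
elim: m => [|m IHm].
  move=> [|n] r c hr hc cm; first by rewrite /minor det_mx00.
  by have := cm ord0.
apply: (TP_cons0 (M := fun l i => walk (2 * i).+2 (2 * l))) => [i|i j|].
- by rewrite muln0 /= muln_eq0.
- by rewrite mulnS.
apply: (TP_row_op (M := fun l i => walk (2 * i).+1 (2 * l).+1)
  (a := fun l => if l is l'.+1 then u (2 * l').+1 else 0) (b := fun l => d (2 * l))
  (l := predn) (g := id)) => //.
- by case=> //= l; rewrite S0.
- by move=> i; lia.
- by move=> i i'; lia.
- move=> [|l] i _; first by rewrite /= !mul0r.
  by rewrite mulnS.
apply: (TP_row_op (M := fun l i => walk (2 * i) (2 * l))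
  (a := fun l => u (2 * l)) (b := fun l => d (2 * l).+1)
  (l := id) (g := succn)) => // l i _.
by rewrite mulnS.
Qed.

(** The matrices F n interpolate between the matrix of [walk_TP] and the Hankel
    matrix: rows up to n are Hankel rows, and row n + l holds the walks of
    length 2 (i + n) to 2 l.  From F n to F n.+1 the walks of the rows
    after n get one step, which leads to G n and to odd heights, then another
    one. *)
Lemma walk_Hankel_TP m : TP_upto m (fun i j => walk (2 * (i + j)) 0).
Proof.
have OTP m' := TP_tr walk_TP m'.
pose F n (j i : nat) :=
  if (j <= n)%N then walk (2 * (i + j)) 0 else walk (2 * (i + n)) (2 * (j - n)).
pose G n (j i : nat) :=
  if (j <= n)%N then walk (2 * (i + j)) 0
  else walk (2 * (i + n)).+1 (2 * (j - n)).-1.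
have FTP n : forall m, TP_upto m (F n).
  elim: n => [|n IHn] m'.
    apply: (TP_row_op (M := fun l i => walk (2 * i) (2 * l))
      (a := fun=> 1) (b := fun=> 0) (l := id) (g := id)) => //; last exact: walk_TP.
    - by move=> i i' /ltnW.
    - move=> j i _; rewrite mul0r addr0 mul1r /F addn0 subn0.
      by case: j => // ; rewrite addn0.
  have GTP : TP_upto m' (G n).
    apply: (TP_row_op (M := F n)
      (a := fun j => if (j <= n)%N then 1 else u (2 * (j - n.+1)))
      (b := fun j => if (j <= n)%N then 0 else d (2 * (j - n.+1)).+1)
      (l := fun j => if (j <= n)%N then j else j.-1) (g := id)) => //.
    - by move=> j; case: ifP.
    - by move=> j; case: ifP.
    - by move=> j; case: ifP => //; lia.
    - by move=> j j'; case: ifP => //; lia.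
    - move=> j i _; rewrite /F /G; case: (leqP j n) => jn.
        by rewrite jn mul0r mul1r addr0.
      have [l ->] : exists l, j = (n + l).+1 by exists (j - n.+1)%N; lia.
      have -> : ((n + l).+1 - n)%N = l.+1 by lia.
      have -> : ((n + l).+1 - n.+1)%N = l by lia.
      have -> : (2 * l.+1)%N = (2 * l).+2 by lia.
      rewrite /=.
      congr (_ * _ + _); case: ifP => [?|_]; last by congr (walk _ _); lia.
      by rewrite (_ : l = 0%N) ?addn0 //; lia.
  apply: (TP_row_op (M := G n)
    (a := fun j => if (j <= n)%N then 1
                   else if j == n.+1 then 0 else u (2 * (j - n.+1)).-1)
    (b := fun j => if (j <= n)%N then 0 else d (2 * (j - n.+1)))
    (l := fun j => if (j <= n)%N then j else j.-1) (g := id)) => //.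
  - by move=> j; case: ifP => // _; case: ifP.
  - by move=> j; case: ifP.
  - by move=> j; case: ifP => //; lia.
  - by move=> j j'; case: ifP => //; lia.
  - move=> j i _; rewrite /F /G; case: (leqP j n) => jn.
      by rewrite leqW // jn mul0r mul1r addr0.
    have [->|[l ->]] : j = n.+1 \/ exists l, j = (n + l).+2.
      have [->|] := eqVneq j n.+1; first by left.
      by right; exists (j - n.+2)%N; lia.
    + have -> : (2 * (i + n.+1))%N = (2 * (i + n)).+2 by lia.
      by rewrite eqxx leqnn subSnn subnn /= !mul0r.
    + have -> : (2 * (i + n.+1))%N = (2 * (i + n)).+2 by lia.
      have -> : ((n + l).+2 - n.+1)%N = l.+1 by lia.
      have -> : ((n + l).+2 - n)%N = l.+2 by lia.
      have -> : ((n + l).+2.-1 - n)%N = l.+1 by lia.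
      have -> : (2 * l.+1)%N = (2 * l).+2 by lia.
      have -> : (2 * l.+2)%N = (2 * l).+4 by lia.
      by rewrite !ifN //; lia.
(* The selected rows of F n are Hankel rows once n bounds their indices. *)
move=> n r c hr hc cm.
have := FTP (\max_(i < n) (r i)) m n r c hr hc cm.
rewrite /minor; congr (S (\det _)); apply/matrixP=> i j; rewrite !mxE /F.
by rewrite ifT 1?addnC //; apply: (leq_bigmax (F := r) i).
Qed.

End TotalPositivity.

Local Open Scope nat_scope.

Lemma uniq_flatten_map (T U : eqType) (F : T -> seq U) (s : seq T) :
    uniq s -> {in s, forall x, uniq (F x)} ->
    {in s &, forall x y t, t \in F x -> t \in F y -> x = y} ->
  uniq (flatten [seq F x | x <- s]).
Proof.
elim: s => //= a s IHs /andP[a_s s_uniq] F_uniq F_inj.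
rewrite cat_uniq F_uniq ?mem_head //= IHs //; last first.
- by move=> x y xs ys; apply: F_inj; rewrite inE ?xs ?ys orbT.
- by move=> x xs; apply: F_uniq; rewrite inE xs orbT.
rewrite andbT; apply/hasPn => t /flatten_mapP[y ys ty]; apply/negP => ta.
by rewrite (F_inj a y _ _ t ta ty) ?ys ?inE ?eqxx ?ys ?orbT // in a_s.
Qed.

Lemma mem_split (T : eqType) (t : T) (s : seq T) :
  t \in s -> exists s1 s2, s = s1 ++ t :: s2.
Proof. by case/splitPr=> s1 s2; exists s1, s2. Qed.

(** * Alternating words with holes *)

(** A word is read as a list of pairs (odd position, even position). *)
Definition config := seq (nat * nat).

Section Configurations.
(* A hole is an odd position holding oo, a number larger than all letters: it
   then obeys the same inequalities as the peak that will replace it. *)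
Variable oo : nat.
Implicit Types (w : config) (a b : nat * nat) (z : config * config).

Definition holes w := count (fun a => a.1 == oo) w.

Definition hole_first w := if w is a :: _ then a.1 == oo else true.

(** The places for a new pair: before a hole or at the end.  The second part
    begins with a hole or is empty, so the same list also enumerates the holes
    that can be filled. *)
Fixpoint splits w : seq (config * config) :=
  if w is a :: w' then
    (if a.1 == oo then [:: ([::], w)] else [::])
    ++ [seq (a :: z.1, z.2) | z <- splits w']
  else [:: ([::], [::])].

(** Letter v opens a pair between the two parts, or fills the hole that begins
    the second part. *)
Definition children v z : seq config :=
  (z.1 ++ (oo, v) :: z.2)
  :: if z.2 is a :: w2 then [:: z.1 ++ (v, a.2) :: w2] else [::].

Fixpoint configs k : seq config :=
  if k is k'.+1 then
    flatten [seq children k z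
            | z <- flatten [seq splits w | w <- configs k']]
  else [:: [::]].

Lemma mem_splits w z : (z \in splits w) = (w == z.1 ++ z.2) && hole_first z.2.
Proof.
elim: w z => [|a w IHw] [w1 w2] /=.
  rewrite inE; case: w1 => [|b w1] //=; case: w2 => //=.
rewrite mem_cat; case: w1 => [|b w1] /=.
  rewrite (_ : (_ \in map _ _) = false) ?orbF; last by apply/mapP => -[].
  transitivity ((w2 == a :: w) && (a.1 == oo)).
    by case: ifP => _; rewrite ?inE ?andbT ?andbF.
  by rewrite eq_sym; case: eqP => // <-.
rewrite (_ : (_ \in (if _ then _ else _)) = false) /=; last by case: ifP.
rewrite eqseq_cons -andbA; apply/mapP/and3P => [[[u1 u2]]|[/eqP -> wE hw]].
  by rewrite IHw /= => /andP[wE hu] [-> -> ->].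
by exists (w1, w2); rewrite // IHw wE.
Qed.

Lemma splits_uniq w : uniq (splits w).
Proof.
elim: w => //= a w IHw; rewrite cat_uniq map_inj_uniq ?IHw ?andbT; last first.
  by move=> [u1 u2] [w1 w2] /= [-> ->].
apply/andP; split; first by case: ifP.
by apply/hasPn => _ /mapP[z _ ->]; case: ifP.
Qed.

(** Every even position holds a letter, hence only the peaks are filtered. *)
Definition letters w : seq nat :=
  [seq a.2 | a <- w] ++ [seq i <- [seq a.1 | a <- w] | i != oo].

(** The second inequality concerns b alone; it is stated here so that a path
    from a dummy pair (0, 0) expresses alternation of the whole word. *)
Definition follows a b := (a.2 < b.1) && (b.2 < b.1).

Lemma path_follows x x' y w :
  path follows (x, y) w = path follows (x', y) w.
Proof. by case: w. Qed.

Definition valid k w :=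
  path follows (0, 0) w && perm_eq (letters w) (iota 1 k).

Definition bounded k a := (0 < a.2 <= k) && ((0 < a.1 <= k) || (a.1 == oo)).

Lemma mem_iota1 k i : (i \in iota 1 k) = (0 < i <= k).
Proof. by rewrite mem_iota add1n ltnS. Qed.

Lemma valid_bounded k w : valid k w -> all (bounded k) w.
Proof.
move=> /andP[_ /perm_mem w_letters]; apply/allP => a aw; apply/andP; split.
  by rewrite -mem_iota1 -w_letters mem_cat map_f.
case: eqP => [_|/eqP a_oo]; rewrite ?orbT // orbF.
rewrite -mem_iota1 -w_letters mem_cat mem_filter a_oo.
by rewrite (map_f (fun b => b.1)) ?orbT.
Qed.

Lemma perm_iotaS k : perm_eq (iota 1 k.+1) (k.+1 :: iota 1 k).
Proof.
have -> : iota 1 k.+1 = iota 1 k ++ [:: k.+1] by rewrite -[k.+1]addn1 iotaD addn1.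
by rewrite perm_catC.
Qed.

Lemma letters_valley v w1 w2 :
  perm_eq (letters (w1 ++ (oo, v) :: w2)) (v :: letters (w1 ++ w2)).
Proof.
apply/seq.permP => P; rewrite /letters /= !map_cat !filter_cat !count_cat /=.
by rewrite eqxx /=; lia.
Qed.

Lemma letters_peak v y w1 w2 : v != oo ->
  perm_eq (letters (w1 ++ (v, y) :: w2))
          (v :: letters (w1 ++ (oo, y) :: w2)).
Proof.
move=> v_oo.
apply/seq.permP => P; rewrite /letters /= !map_cat !filter_cat !count_cat /=.
by rewrite v_oo eqxx /=; lia.
Qed.

Lemma last_bounded k w : k < oo -> all (bounded k) w -> (last (0, 0) w).2 < oo.
Proof.
move=> k_oo /allP w_bd; have := mem_last (0, 0) w.
rewrite inE => /predU1P[->|/w_bd] /=; first by lia.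
by move/andP=> [+ _]; lia.
Qed.

Lemma children_valid k w z w' : k.+1 < oo -> valid k w ->
  z \in splits w -> w' \in children k.+1 z -> valid k.+1 w'.
Proof.
case: z => w1 w2 k_oo w_val; rewrite mem_splits => /andP[/eqP /= wE w2_hole].
have := valid_bounded w_val; rewrite wE all_cat => /andP[bd1 bd2].
have last_oo := last_bounded (ltnW k_oo) bd1.
move: w_val; rewrite /valid wE cat_path => /andP[/andP[alt1 alt2] w_perm].
rewrite !inE => /orP[/eqP ->|].
  rewrite cat_path alt1 /=; apply/andP; split.
    apply/andP; split; first by rewrite /follows /= last_oo.
    case: w2 w2_hole alt2 {bd2 w_perm wE} => //= b w2 /eqP b_oo.
    by rewrite /follows b_oo k_oo => /andP[/andP[_ ->]].
  apply: perm_trans (letters_valley _ _ _) _.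
  by rewrite perm_sym (perm_trans (perm_iotaS k)) // perm_cons perm_sym.
case: w2 w2_hole bd2 alt2 w_perm {wE} => // -[x y] w2 /= /eqP ->.
move=> /andP[y_bd bd2] /andP[_ alt2] w_perm; rewrite inE => /eqP ->.
rewrite cat_path alt1 /=; apply/andP; split.
  move: y_bd; rewrite /bounded /= => y_bd.
  rewrite (path_follows _ oo) alt2 /follows /= andbT.
  apply/andP; split; last by lia.
  have := mem_last (0, 0) w1; rewrite inE => /predU1P[->//|].
  by move=> /(allP bd1)/andP[/andP[_ le_k] _]; rewrite ltnS.
apply: perm_trans (letters_peak _ _ _ _) _; first by lia.
by rewrite perm_sym (perm_trans (perm_iotaS k)) // perm_cons perm_sym.
Qed.

(** The largest letter at an even position has holes around it, being smaller
    than its neighbours, so its pair can be deleted; at an odd position it is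
    turned back into a hole. *)
Lemma valid_child k w' : k.+1 < oo -> valid k.+1 w' ->
  exists w z, [/\ valid k w, z \in splits w & w' \in children k.+1 z].
Proof.
move=> k_oo w'_val; have bd' := valid_bounded w'_val.
case/andP: w'_val => alt' perm'.
have perm_del (s : seq nat) : perm_eq (letters w') (k.+1 :: s) ->
    perm_eq s (iota 1 k).
  move=> s_perm; rewrite -(perm_cons k.+1) perm_sym.
  by rewrite -(permPl (perm_iotaS k)) -(permPl perm').
have : k.+1 \in letters w' by rewrite (perm_mem perm') mem_iota1 leqnn.
rewrite mem_cat mem_filter => /orP[|/andP[_]] /mapP[[x y] /= /mem_split].
  move=> [w1 [w2 w'E]] yE; rewrite -{y}yE in w'E.
  have x_oo : x = oo.
    have /(allP bd') : (x, k.+1) \in w' by rewrite w'E mem_cat mem_head orbT.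
    move: alt'; rewrite w'E cat_path /= => /and3P[_ /andP[_ /= kx] _].
    by rewrite /bounded /= => /andP[_ /orP[|/eqP//]]; lia.
  rewrite {x}x_oo in w'E.
  have hole2 : hole_first w2.
    case: w2 w'E => //= b w2 w'E.
    have /(allP bd') : b \in w' by rewrite w'E mem_cat !inE eqxx !orbT.
    move: alt'; rewrite w'E cat_path /= => /and4P[_ _ /andP[/= kb _] _].
    by rewrite /bounded => /andP[_ /orP[|//]]; lia.
  exists (w1 ++ w2), (w1, w2); split; last by rewrite w'E mem_head.
    apply/andP; split; last first.
      by apply: perm_del; rewrite w'E; apply: letters_valley.
    move: alt' bd'; rewrite w'E cat_path all_cat /=.
    move=> /and3P[alt1 last1 alt2] /and3P[bd1 _ bd2]; rewrite cat_path alt1 /=.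
    case: w2 hole2 alt2 {w'E last1} bd2 => //= b w2 /eqP b_oo.
    move=> /andP[/andP[_ b_alt] ->] _.
    rewrite /follows b_alt !andbT b_oo.
    by apply: (@last_bounded k.+1).
  by rewrite mem_splits eqxx.
move=> [w1 [w2 w'E]] xE; rewrite -{x}xE in w'E.
exists (w1 ++ (oo, y) :: w2), (w1, (oo, y) :: w2); split; last first.
- by rewrite w'E !inE eqxx orbT.
- by rewrite mem_splits /= !eqxx.
apply/andP; split; last first.
  by apply: perm_del; rewrite w'E; apply: letters_peak; lia.
move: alt' bd'; rewrite w'E !cat_path all_cat /=.
move=> /and3P[-> /andP[_ /= yk] alt2] /and3P[bd1 _ _].
rewrite (path_follows _ k.+1) alt2 /follows /= andbT.
apply/andP; split; last by lia.
exact: (@last_bounded k.+1).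
Qed.

Lemma mem_configs k w : k < oo -> (w \in configs k) = valid k w.
Proof.
elim: k w => [|k IHk] w k_oo.
  rewrite inE /valid; case: w => //= a w.
  apply/esym/negbTE; rewrite negb_and; apply/orP; right.
  by apply/negP => /perm_size.
apply/flatten_mapP/idP => [[z /flatten_mapP[w0]]|w_val].
  by rewrite (IHk _ (ltnW k_oo)) => w0_val; apply: children_valid.
have [w0 [z [w0_val zw0 wz]]] := valid_child k_oo w_val.
by exists z => //; apply/flatten_mapP; exists w0; rewrite // (IHk _ (ltnW k_oo)).
Qed.

(** Inverse of [children]: it recovers the place of the insertion of v from the
    resulting word, which makes [configs] duplicate-free. *)
Definition unstep v w : config * config :=
  let i := find (fun a => (a.1 == v) || (a.2 == v)) w in
  let y := (nth (0, 0) w i).2 in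
  (take i w, if y == v then drop i.+1 w else (oo, y) :: drop i.+1 w).

Lemma unstepK k w z w' : k.+1 < oo -> valid k w -> z \in splits w ->
  w' \in children k.+1 z -> unstep k.+1 w' = z.
Proof.
case: z => w1 w2 k_oo /valid_bounded bd; rewrite mem_splits => /andP[/eqP /= wE].
move: bd; rewrite {w}wE all_cat => /andP[bd1 bd2] hole2.
have no1 : has (fun a => (a.1 == k.+1) || (a.2 == k.+1)) w1 = false.
  apply/hasPn => a /(allP bd1) /andP[] ? /orP[|/eqP ->]; last by lia.
  by rewrite negb_or; lia.
rewrite !inE /unstep => /orP[/eqP ->|].
  rewrite find_cat no1 /= eqxx orbT addn0 nth_cat ltnn subnn.
  by rewrite take_size_cat //= eqxx -cat_rcons drop_size_cat ?size_rcons.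
case: w2 hole2 bd2 => // -[x y] w2 /= /eqP -> /andP[/andP[/= y_k _] _].
rewrite inE => /eqP ->.
rewrite find_cat no1 /= eqxx /= addn0 nth_cat ltnn subnn take_size_cat //=.
rewrite ifN; last by lia.
by rewrite -cat_rcons drop_size_cat ?size_rcons.
Qed.

Lemma configs_uniq k : k < oo -> uniq (configs k).
Proof.
elim: k => [|k IHk] // k_oo /=; apply: uniq_flatten_map => [||z1 z2].
- apply: uniq_flatten_map => [||w1 w2 _ _ z]; first exact/IHk/ltnW.
    by move=> w _; apply: splits_uniq.
  by rewrite !mem_splits => /andP[/eqP -> _] /andP[/eqP -> _].
- move=> [w1 w2] _; rewrite /children /=; case: w2 => //= a w2.
  rewrite inE andbT; apply/eqP => /(congr1 size).
  by rewrite !size_cat /=; lia.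
move=> /flatten_mapP[w1 + zw1] /flatten_mapP[w2 + zw2].
rewrite !mem_configs ?(ltnW k_oo) // => w1_val w2_val w' w'1 w'2.
by rewrite -(unstepK k_oo w1_val zw1 w'1) (unstepK k_oo w2_val zw2 w'2).
Qed.

End Configurations.

(** * Statistics of words under insertion *)

Fixpoint pairsum (g : nat * nat -> nat * nat -> nat) (w : config) : nat :=
  if w is a :: w' then \sum_(b <- w') g a b + pairsum g w' else 0.

Lemma pairsum_mid g a w1 w2 :
  pairsum g (w1 ++ a :: w2)
  = pairsum g (w1 ++ w2) + \sum_(b <- w1) g b a + \sum_(b <- w2) g a b.
Proof.
elim: w1 => [|b w1 IHw] /=; first by rewrite big_nil addn0 addnC.
by rewrite IHw !big_cat !big_cons /=; lia.
Qed.

(** Contribution of two pairs, a before b, to the patterns 31-2 and 2-31: one of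
    the pairs is the descent 31, and either entry of the other may be the 2.
    Holes contribute nothing as a 2 and are adequate as a 3. *)
Definition in_31_2 a b : nat := (a.2 < b.1 < a.1) + (a.2 < b.2 < a.1).
Definition in_2_31 a b : nat := (b.2 < a.1 < b.1) + (b.2 < a.2 < b.1).

Section Statistics.
Variable oo : nat.
Implicit Types (w : config) (a b : nat * nat) (z : config * config).

(** Left-to-right maxima: a letter at an even position is smaller than the
    letter before it, so only peaks count; a hole hides all that follows. *)
Fixpoint records m w : nat :=
  if w is a :: w' then (m < a.1 < oo) + records (maxn m a.1) w' else 0.

(** Counting an open hole as k makes this sum grow by the number of holes at
    each insertion; without holes it is the exponent of h. *)
Definition area k w := \sum_(a <- w) (minn a.1 k - a.2).

Lemma records_cat m w1 w2 :
  records m (w1 ++ w2)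
  = records m w1 + records (foldl maxn m [seq a.1 | a <- w1]) w2.
Proof. by elim: w1 m => //= a w1 IHw m; rewrite IHw addnA. Qed.

Lemma records_eq0 m w :
  {in w, forall a, a.1 <= m \/ oo <= a.1} -> records m w = 0.
Proof.
elim: w m => //= a w IHw m w_m; rewrite IHw => [|b bw].
  by have := w_m a (mem_head _ _); lia.
by have := w_m b; rewrite inE bw orbT => /(_ isT); lia.
Qed.

Lemma records_hole_first m w1 w2 : hole_first oo w2 ->
  {in w2, forall a, a.1 <= oo} -> records m (w1 ++ w2) = records m w1.
Proof.
move=> hole2 w2_oo; rewrite records_cat.
case: w2 hole2 w2_oo => [|b w2 /eqP b_oo w2_oo].
  by rewrite addn0.
rewrite /= b_oo ltnn andbF -[RHS]addn0; congr (_ + _); apply: records_eq0 => a aw2.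
by have := w2_oo a; rewrite inE aw2 orbT => /(_ isT); lia.
Qed.

Variable k : nat.
Hypothesis k_oo : k.+1 < oo.

Lemma bounded_le_oo w : all (bounded oo k) w -> {in w, forall a, a.1 <= oo}.
Proof.
by move=> /allP w_bd a /w_bd/andP[_ /orP[|/eqP ->//]]; lia.
Qed.

Lemma holesE w : \sum_(a <- w) (a.1 == oo) = holes oo w.
Proof. by elim: w => [|a w IHw]; rewrite ?big_nil ?big_cons //= IHw. Qed.

Lemma sum_valley_l w : all (bounded oo k) w ->
  \sum_(a <- w) in_31_2 a (oo, k.+1) = holes oo w
  /\ \sum_(a <- w) in_2_31 a (oo, k.+1) = 0.
Proof.
move=> /allP w_bd; rewrite -holesE; split.
  by apply: eq_big_seq => a /w_bd; rewrite /bounded /in_31_2 /=; lia.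
by apply: big1_seq => a /w_bd; rewrite /bounded /in_2_31 /=; lia.
Qed.

Lemma sum_valley_r w : all (bounded oo k) w ->
  \sum_(a <- w) in_31_2 (oo, k.+1) a = 0
  /\ \sum_(a <- w) in_2_31 (oo, k.+1) a = holes oo w.
Proof.
move=> /allP w_bd; rewrite -holesE; split.
  by apply: big1_seq => a /w_bd; rewrite /bounded /in_31_2 /=; lia.
by apply: eq_big_seq => a /w_bd; rewrite /bounded /in_2_31 /=; lia.
Qed.

Lemma sum_peak_l y w : 0 < y <= k -> all (bounded oo k) w ->
  \sum_(a <- w) in_31_2 a (k.+1, y)
    = \sum_(a <- w) in_31_2 a (oo, y) + holes oo w
  /\ \sum_(a <- w) in_2_31 a (k.+1, y) = \sum_(a <- w) in_2_31 a (oo, y).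
Proof.
move=> y_k /allP w_bd; rewrite -holesE -big_split.
split; apply: eq_big_seq => a /w_bd; rewrite /bounded /in_31_2 /in_2_31 /=; lia.
Qed.

Lemma sum_peak_r y w : 0 < y <= k -> all (bounded oo k) w ->
  \sum_(a <- w) in_31_2 (k.+1, y) a = \sum_(a <- w) in_31_2 (oo, y) a
  /\ \sum_(a <- w) in_2_31 (k.+1, y) a
     = \sum_(a <- w) in_2_31 (oo, y) a + holes oo w.
Proof.
move=> y_k /allP w_bd; rewrite -holesE -big_split.
split; apply: eq_big_seq => a /w_bd; rewrite /bounded /in_31_2 /in_2_31 /=; lia.
Qed.

Lemma areaS w : all (bounded oo k) w -> area k.+1 w = area k w + holes oo w.
Proof.
move=> /allP w_bd; rewrite -holesE -big_split; apply: eq_big_seq => a /w_bd.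
by rewrite /bounded /=; lia.
Qed.

(** The new largest letter exceeds everything before it unless a hole is
    there. *)
Lemma records_hole_max w m : all (bounded oo k) w -> m <= k ->
  (foldl maxn m [seq a.1 | a <- w] < k.+1) = (holes oo w == 0).
Proof.
elim: w m => //= a w IHw m /andP[a_bd w_bd] m_k.
have [a_oo|a_oo] := eqVneq a.1 oo.
  apply/negbTE; rewrite -leqNgt.
  have : k < maxn m a.1 by lia.
  move: (maxn m a.1) => m'; elim: (w) m' => //= b w' IHw' m' m'_k.
  by apply: IHw'; lia.
by rewrite IHw //; move: a_bd; rewrite /bounded; lia.
Qed.

End Statistics.

(** * The walk followed by the number of holes *)

Section Weights.
Variables (A : comNzRingType) (x c h p q : A) (oo : nat).
Implicit Types (w : config) (z : config * config).
Local Open Scope ring_scope.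

Definition weight k w : A :=
  x ^+ size w * c ^+ records oo 0 w * h ^+ area k w
  * p ^+ pairsum in_31_2 w * q ^+ pairsum in_2_31 w.

Lemma weight_valley k w1 w2 : (k.+1 < oo)%N ->
    all (bounded oo k) (w1 ++ w2) -> hole_first oo w2 ->
  weight k.+1 (w1 ++ (oo, k.+1) :: w2)
  = weight k (w1 ++ w2)
    * (x * h ^+ holes oo (w1 ++ w2) * p ^+ holes oo w1 * q ^+ holes oo w2).
Proof.
move=> k_oo bd hole2; have := bd; rewrite all_cat => /andP[bd1 bd2].
have [l1 l2] := sum_valley_l k_oo bd1; have [r1 r2] := sum_valley_r k_oo bd2.
have le2 := bounded_le_oo k_oo bd2.
rewrite /weight !pairsum_mid l1 l2 r1 r2 !addn0.
rewrite !records_hole_first //= => [|a]; last first.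
  by rewrite inE => /predU1P[->//|/le2].
have -> : area k.+1 (w1 ++ (oo, k.+1) :: w2)
        = (area k (w1 ++ w2) + holes oo (w1 ++ w2))%N.
  rewrite -areaS // /area !big_cat big_cons /=.
  by rewrite (minn_idPr _) ?subnn // ltnW.
by rewrite !size_cat /= addnS exprS !exprD; ring.
Qed.

Lemma weight_peak k y w1 w2 : (k.+1 < oo)%N ->
    all (bounded oo k) (w1 ++ (oo, y) :: w2) ->
  weight k.+1 (w1 ++ (k.+1, y) :: w2)
  = weight k (w1 ++ (oo, y) :: w2)
    * (h ^+ holes oo (w1 ++ (oo, y) :: w2) * p ^+ holes oo w1
       * q ^+ holes oo w2 * c ^+ (holes oo w1 == 0)%N).
Proof.
move=> k_oo bd; have := bd; rewrite all_cat /= => /and3P[bd1 /andP[/= y_k _] bd2].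
have [l1 l2] := sum_peak_l k_oo y_k bd1.
have [r1 r2] := sum_peak_r k_oo y_k bd2.
rewrite /weight !pairsum_mid l1 l2 r1 r2.
have -> : area k.+1 (w1 ++ (k.+1, y) :: w2)
        = (area k (w1 ++ (oo, y) :: w2) + holes oo (w1 ++ (oo, y) :: w2))%N.
  rewrite -areaS // /area !big_cat !big_cons /=.
  by rewrite (minn_idPr (ltnW k_oo)) minnn.
have -> : records oo 0 (w1 ++ (k.+1, y) :: w2)
        = (records oo 0 (w1 ++ (oo, y) :: w2) + (holes oo w1 == 0))%N.
  rewrite [in RHS](@records_hole_first _ _ _ ((oo, y) :: w2))
    ?/hole_first ?eqxx // => [|a]; last first.
    by rewrite inE => /predU1P[->//|/(bounded_le_oo k_oo bd2)].
  rewrite records_cat /= k_oo andbT; congr (_ + _)%N.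
  rewrite records_eq0 ?addn0 => [|a /(allP bd2)]; last first.
    by rewrite /bounded; lia.
  congr nat_of_bool.
  rewrite (records_hole_max k_oo bd1) //.
by rewrite !size_cat /= !exprD; ring.
Qed.

(** Each number of holes to the left is reached by exactly one place. *)
Lemma sum_splits w (F : nat -> nat -> A) :
  \sum_(z <- splits oo w) F (holes oo z.1) (holes oo z.2)
  = \sum_(i < (holes oo w).+1) F i (holes oo w - i)%N.
Proof.
elim: w F => [|a w IHw] F.
  by rewrite big_seq1 big_ord_recl big_ord0 addr0.
rewrite /= big_cat big_map /=.
have [a_oo|a_oo] := eqVneq a.1 oo; last first.
  by rewrite big_nil add0r !add0n; apply: IHw.
rewrite big_seq1 !add1n big_ord_recl /= a_oo eqxx subn0; congr (_ + _).
rewrite -(IHw (fun i => F i.+1)); first by [].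
Qed.

Definition up n : A := x * h ^+ n * \sum_(i < n.+1) p ^+ i * q ^+ (n - i).

Definition down n : A :=
  h ^+ n.+1 * \sum_(i < n.+1) p ^+ i * q ^+ (n - i) * c ^+ (i == 0 :> nat)%N.

Definition total k m : A :=
  \sum_(w <- configs oo k) (holes oo w == m)%:R * weight k w.

(** The two summands are the openings of a pair and the fillings of a hole; the
    last place, which has no hole to its right, offers no filling. *)
Lemma sum_children k m w : (k.+1 < oo)%N -> valid oo k w ->
  \sum_(z <- splits oo w) \sum_(w' <- children oo k.+1 z)
     (holes oo w' == m)%:R * weight k.+1 w'
  = weight k w * (((holes oo w).+1 == m)%:R * up (holes oo w)
                  + (holes oo w == m.+1)%:R * down m).
Proof.
move=> k_oo /valid_bounded w_bd; pose n := holes oo w.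
(* i and j are the numbers of holes to the left and to the right of the place;
   in a filling the filled hole is one of the j. *)
pose F i j := weight k w * ((n.+1 == m)%:R * (x * h ^+ n * p ^+ i * q ^+ j)
  + (if j is j'.+1 then
       (n == m.+1)%:R * (h ^+ n * p ^+ i * q ^+ j' * c ^+ (i == 0)%N)
     else 0)).
rewrite (eq_big_seq (fun z => F (holes oo z.1) (holes oo z.2))) => [|[w1 w2]].
  rewrite sum_splits -mulr_sumr; congr (_ * _); rewrite big_split /=; congr (_ + _).
    by rewrite /up !mulr_sumr; apply: eq_bigr => i _; ring.
  case: (eqVneq n m.+1) => [n_m|n_m]; last first.
    by rewrite mul0r big1 // => i _; case: (_ - _)%N => // *; rewrite mul0r.
  rewrite big_ord_recr /= subnn addr0 mul1r /down -/n n_m mulr_sumr.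
  apply: eq_bigr => i _; rewrite subSn ?mul1r /=; last by rewrite -ltnS.
  by ring.
rewrite mem_splits => /andP[/eqP /= wE hole2].
rewrite /children /= big_cons /F; move: w_bd; rewrite {}/F {}/n wE => w_bd.
rewrite weight_valley //.
have -> : holes oo (w1 ++ (oo, k.+1) :: w2) = (holes oo (w1 ++ w2)).+1.
  by rewrite /holes !count_cat /= eqxx; lia.
rewrite mulrDr; congr (_ + _); first by ring.
case: w2 w_bd hole2 {wE} => [|[y0 y] w2] w_bd /=; first by rewrite big_nil mulr0.
move=> /eqP y0E; rewrite {y0}y0E in w_bd *.
rewrite big_seq1 eqxx /= weight_peak //.
have -> : (holes oo (w1 ++ (oo, y) :: w2) == m.+1)
        = (holes oo (w1 ++ (k.+1, y) :: w2) == m).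
  by rewrite /holes !count_cat /= eqxx (ltn_eqF k_oo); lia.
by ring.
Qed.

Lemma total_walk k m : (k < oo)%N -> total k m = walk up down k m.
Proof.
elim: k m => [|k IHk] m k_oo.
  rewrite /total big_seq1 /weight /area big_nil /= eq_sym !expr0; ring.
rewrite /total /= big_flatten /= big_map big_flatten /= big_map.
rewrite (eq_big_seq (fun w => weight k w
    * (((holes oo w).+1 == m)%:R * up (holes oo w)
       + (holes oo w == m.+1)%:R * down m))); last first.
  by move=> w; rewrite mem_configs ?(ltnW k_oo) // => w_val; apply: sum_children.
rewrite -!IHk ?(ltnW k_oo) // /total mulr_sumr.
case: m => [|m].
  by rewrite add0r; apply: eq_bigr => w _; rewrite mul0r add0r; ring.
rewrite -IHk ?(ltnW k_oo) // /total mulr_sumr -big_split.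
apply: eq_bigr => w _; rewrite eqSS /=.
by case: eqVneq => [->|_]; rewrite ?mulr1n ?mulr0n; ring.
Qed.

End Weights.

(** * Alternating permutations as words without holes *)

Definition flat (w : config) : seq nat := flatten [seq [:: a.1; a.2] | a <- w].

Lemma size_flat w : size (flat w) = 2 * size w.
Proof. by elim: w => //= a w ->; lia. Qed.

Lemma nth_flat w i : i < size w ->
  nth 0 (flat w) (2 * i) = (nth (0, 0) w i).1
  /\ nth 0 (flat w) (2 * i).+1 = (nth (0, 0) w i).2.
Proof.
elim: w i => //= a w IHw [|i] // i_w; rewrite mulnS /=.
exact: IHw.
Qed.

Lemma perm_letters_flat oo w :
  holes oo w = 0 -> perm_eq (letters oo w) (flat w).
Proof.
move=> w0; apply/seq.permP => P; rewrite /letters.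
elim: w w0 => //= a w IHw; case: eqVneq => //= a_oo; rewrite add0n => /IHw.
by rewrite !count_cat /= => <-; lia.
Qed.

Lemma sum_pairs F m : \sum_(1 <= i < (2 * m).+1) F i
  = \sum_(0 <= i < m) (F (2 * i).+1 + F (2 * i).+2).
Proof.
elim: m => [|m IHm]; first by rewrite !big_geq.
by rewrite mulnS add2n 2?big_nat_recr //= IHm big_nat_recr //= addnA.
Qed.

Lemma flat_mkseq (L : nat -> nat) m :
  flat (mkseq (fun i => (L (2 * i).+1, L (2 * i).+2)) m)
  = [seq L i | i <- iota 1 (2 * m)].
Proof.
elim: m => [|m IHm] //.
rewrite mulnS [2 + _]addnC iotaD map_cat -IHm mkseqS -cats1.
by rewrite /flat map_cat flatten_cat /= add1n.
Qed.

Lemma pairsum_mkseq g (F : nat -> nat * nat) m :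
  pairsum g (mkseq F m) = \sum_(0 <= b < m) \sum_(0 <= a < b) g (F a) (F b).
Proof.
elim: m => [|m IHm]; first by rewrite big_geq.
rewrite mkseqS -cats1 big_nat_recr //= -IHm pairsum_mid cats0 big_nil addn0.
by rewrite big_map /index_iota subn0.
Qed.

Lemma foldl_maxn_lt m (r : seq nat) x :
  (foldl maxn m r < x) = (m < x) && all (fun i => i < x) r.
Proof. by elim: r m => [|i r IHr] m /=; rewrite ?andbT // IHr gtn_max andbA. Qed.

Lemma records_mkseq oo (F : nat -> nat * nat) m :
  records oo 0 (mkseq F m)
  = \sum_(0 <= b < m) ((0 < (F b).1 < oo)
                       && all (fun a => (F a).1 < (F b).1) (iota 0 b)).
Proof.
elim: m => [|m IHm]; first by rewrite big_geq.
rewrite mkseqS -cats1 big_nat_recr //= -IHm records_cat /= addn0 foldl_maxn_lt.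
by rewrite /mkseq -map_comp all_map andbAC.
Qed.

Lemma exists_perm N (r : seq nat) : perm_eq r (iota 1 N) ->
  exists s : 'S_N, forall i, i < N -> letter s i.+1 = nth 0 r i.
Proof.
move=> r_perm; have r_size : size r = N by rewrite (perm_size r_perm) size_iota.
have r_uniq : uniq r by rewrite (perm_uniq r_perm) iota_uniq.
have r_mem (i : 'I_N) : 0 < nth 0 r i <= N.
  by rewrite -mem_iota1 -(perm_mem r_perm) mem_nth ?r_size.
have r_lt (i : 'I_N) : (nth 0 r i).-1 < N by have := r_mem i; lia.
have r_inj : injective (fun i : 'I_N => Ordinal (r_lt i)).
  move=> i j [] Eij; apply/val_inj/eqP.
  rewrite -(nth_uniq 0 _ _ r_uniq) ?r_size ?ltn_ord //; apply/eqP.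
  move: Eij (r_mem i) (r_mem j).
  by case: (nth 0 r i) (nth 0 r j) => [|a] [|b] //= ->.
exists (perm r_inj) => i iN; rewrite letterE permE /=.
by have := r_mem (Ordinal iN); case: nth.
Qed.

Section Pairs.
Variable n : nat.
Implicit Type s : 'S_(2 * n).

Definition pairs s : config :=
  mkseq (fun i => (letter s (2 * i).+1, letter s (2 * i).+2)) n.

Lemma letter_range s i : 0 < i <= 2 * n -> 0 < letter s i <= 2 * n.
Proof.
case: i => //= i i_n; rewrite (letterE s (i_n : i < 2 * n)).
by rewrite ltn_ord.
Qed.

Lemma letter_last s : letter s (2 * n).+1 = 0.
Proof. by rewrite /letter insubN // ltnn. Qed.

Lemma perm_map_letter s :
  perm_eq [seq letter s i | i <- iota 1 (2 * n)] (iota 1 (2 * n)).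
Proof.
have L_uniq : uniq [seq letter s i | i <- iota 1 (2 * n)].
  by rewrite map_inj_in_uniq ?iota_uniq //; apply: letter_inj.
apply: uniq_perm => //; first exact: iota_uniq.
have [i /mapP[j + ->]||//] := uniq_min_size L_uniq (s2 := iota 1 (2 * n)).
  by rewrite !mem_iota1; apply: letter_range.
by rewrite size_map.
Qed.

Lemma pairs_inj : injective pairs.
Proof.
move=> s t st; apply/permP => -[i iN]; apply/val_inj/eq_add_S.
rewrite -!letterE.
have := congr1 flat st; rewrite !flat_mkseq => /(congr1 (nth 0 ^~ i)).
by rewrite !(nth_map 0) ?size_iota // nth_iota // add1n.
Qed.

Lemma holes_pairs s : holes (2 * n).+1 (pairs s) = 0.
Proof.
apply/eqP; rewrite -leqn0 leqNgt -has_count; apply/hasPn => a /mapP[i + ->] /=.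
rewrite mem_iota => i_n; have : 0 < (2 * i).+1 <= 2 * n by lia.
by move/(letter_range s); lia.
Qed.

Lemma alternating_pairs s :
  alternating s = path follows (0, 0) (pairs s).
Proof.
apply/allP/(pathP (0, 0)) => [alt i|fol i].
  rewrite size_mkseq => i_n; rewrite nth_mkseq // /follows /=.
  apply/andP; split; last first.
    by have := alt (2 * i).+1; rewrite mem_iota ifT; [apply; lia|lia].
  case: i i_n => [|i] i_n /=.
    by rewrite muln0; have := @letter_range s 1; lia.
  rewrite nth_mkseq /=; last by lia.
  have := alt (2 * i).+2; rewrite mem_iota ifN; last by lia.
  by rewrite mulnS; apply; lia.
rewrite mem_iota => i_n; case: ifP => i_odd.
  have [j jE] : exists j, i = (2 * j).+1 by exists i./2; lia.
  rewrite {i}jE in i_n i_odd *; have := fol j; rewrite size_mkseq.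
  by move=> /(_ ltac:(lia))/andP[_]; rewrite nth_mkseq //; lia.
have [j jE] : exists j, i = (2 * j).+2 by exists i./2.-1; lia.
rewrite {i}jE in i_n i_odd *; have := fol j.+1; rewrite size_mkseq.
move=> /(_ ltac:(lia))/andP[+ _] /=.
by rewrite /= !nth_mkseq ?mulnS ?add2n //; lia.
Qed.

Lemma valid_pairs s : alternating s -> valid (2 * n).+1 (2 * n) (pairs s).
Proof.
move=> alt; rewrite /valid -alternating_pairs alt /=.
apply: perm_trans (perm_letters_flat (holes_pairs s)) _.
by rewrite flat_mkseq perm_map_letter.
Qed.

Lemma valid_is_pairs w : valid (2 * n).+1 (2 * n) w -> holes (2 * n).+1 w = 0 ->
  exists2 s, alternating s & w = pairs s.
Proof.
move=> /andP[w_alt w_perm] w0; move: w_perm.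
rewrite (permPl (perm_letters_flat w0)) => w_perm.
have w_size : size w = n.
  by have := perm_size w_perm; rewrite size_flat size_iota; lia.
have [s sE] := exists_perm w_perm.
suff wE : w = pairs s by exists s; rewrite // alternating_pairs -wE.
apply: (@eq_from_nth _ (0, 0)) => [|i i_w]; first by rewrite size_mkseq.
have [E1 E2] := nth_flat i_w; rewrite w_size in i_w.
rewrite nth_mkseq // !sE ?E1 ?E2; try lia.
by case: nth.
Qed.

Section Alternating.
Variable s : 'S_(2 * n).
Hypothesis alt : alternating s.
Local Notation L := (letter s).

Lemma alt_odd i : i < n -> L (2 * i).+2 < L (2 * i).+1.
Proof.
move=> i_n; have := allP alt (2 * i).+1.
by rewrite mem_iota ifT; [apply; lia | lia].
Qed.

Lemma alt_even i : i.+1 < n -> L (2 * i).+2 < L (2 * i).+3.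
Proof.
move=> i_n; have := allP alt (2 * i).+2.
by rewrite mem_iota ifN; [apply; lia | lia].
Qed.

Lemma des_pairs : des s = size (pairs s).
Proof.
rewrite size_mkseq /des (eq_in_count (a2 := odd)) => [|i i_in].
  elim: (n) => // -[|m] // IHm.
  have -> : (2 * m.+2).-1 = (2 * m.+1).-1 + 2 by lia.
  rewrite iotaD count_cat IHm /=; lia.
have := allP alt i i_in; case: ifP => // _ ?.
by apply/negbTE; lia.
Qed.

(** Even positions are followed by an ascent, so the descents of the pattern are
    the pairs themselves. *)
Lemma pat_31_2_pairs : pat_31_2 s = pairsum in_31_2 (pairs s).
Proof.
rewrite /pat_31_2 sum_pairs pairsum_mkseq; apply: eq_big_nat => b b_n.
have odd_pos v : \sum_(1 <= i < (2 * b).+1) (L i.+1 < v < L i)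
    = \sum_(0 <= a < b) (L (2 * a).+2 < v < L (2 * a).+1).
  rewrite sum_pairs; apply: eq_big_nat => a a_b.
  by have := @alt_even a; lia.
by rewrite odd_pos big_nat_recr //= odd_pos ltnn addn0 -big_split.
Qed.

Lemma pat_2_31_pairs : pat_2_31 s = pairsum in_2_31 (pairs s).
Proof.
have [n0|n0] := posnP n.
  by rewrite /pat_2_31 pairsum_mkseq [LHS]big_geq ?[RHS]big_geq; lia.
rewrite /pat_2_31 pairsum_mkseq.
(* Position 2n is excluded from the definition of the statistic although the
   boundary letter 0 makes it a descent: G discards it with the other even
   positions. *)
pose G j := if odd j then \sum_(1 <= i < j) (L j.+1 < L i < L j) else 0.
transitivity (\sum_(1 <= j < (2 * n).+1) G j).
  rewrite big_nat_recr /=; last by lia.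
  rewrite /G oddM /= addn0; apply: eq_big_nat => j j_n.
  case: ifP => // j_odd; apply: big1 => i _.
  have := @alt_even j./2.-1; rewrite (_ : (2 * _).+2 = j); last by lia.
  by lia.
rewrite sum_pairs; apply: eq_big_nat => b b_n.
rewrite /G /= oddM /= addn0 sum_pairs; apply: eq_big_nat => a a_b.
by [].
Qed.

Lemma records_pairs : records (2 * n).+1 0 (pairs s) = lmax s.
Proof.
rewrite records_mkseq /lmax /Lmax size_map size_filter.
rewrite -sum1_count [RHS]big_mkcond /=.
have -> : iota 1 (2 * n) = index_iota 1 (2 * n).+1 by rewrite /index_iota subn1.
rewrite sum_pairs; apply: eq_big_nat => b b_n.
rewrite [X in _ = _ + X]ifN ?addn0; last first.
  apply/allPn; exists (2 * b).+1; first by rewrite mem_iota1; lia.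
  by rewrite -leqNgt ltnW // alt_odd; lia.
have := @letter_range s (2 * b).+1 => /(_ _)/andP[|-> Lb]; first by lia.
rewrite ltnS Lb /=; congr nat_of_bool; apply/allP/allP => lt_b i.
  rewrite mem_iota1 => i_b.
  have i2 : i.-1./2 \in iota 0 b by rewrite mem_iota; lia.
  have := lt_b _ i2; have := @alt_odd i.-1./2.
  have [i_odd|i_even] := boolP (odd i).
    by have -> : (2 * i.-1./2).+1 = i by lia.
  by have -> : (2 * i.-1./2).+2 = i; lia.
by rewrite mem_iota => i_b; apply: lt_b; rewrite mem_iota1; lia.
Qed.

Lemma PkE : Pk s = [seq L i | i <- iota 1 (2 * n) & odd i].
Proof.
congr map; apply: eq_in_filter => i; rewrite mem_iota1 => i_n.
have [i_odd|i_even] := boolP (odd i).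
  have := @alt_odd i./2; have := @alt_even i./2.-1.
  have := @letter_range s i.
  have -> : (2 * i./2).+2 = i.+1 by lia.
  have -> : (2 * i./2).+1 = i by lia.
  have [->|i1] := eqVneq i 1; first by move=> /(_ _)/andP[|-> _ _ ->]; lia.
  have -> : (2 * i./2.-1).+2 = i.-1 by lia.
  have -> : i.-1.+1 = i by lia.
  by move=> ? ? ?; lia.
have := @alt_odd i./2.-1.
have -> : (2 * i./2.-1).+2 = i by lia.
have -> : (2 * i./2.-1).+1 = i.-1 by lia.
by move=> ?; lia.
Qed.

Lemma lmaxpk_lmax : lmaxpk s = lmax s.
Proof.
rewrite /lmaxpk /lmax (all_filterP _) //; apply/allP => v /mapP[i].
rewrite mem_filter => /andP[i_max i_in] ->.
rewrite PkE; apply: map_f; rewrite mem_filter i_in andbT.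
apply: contraLR i_max => i_even; rewrite mem_iota1 in i_in.
apply/allPn; exists i.-1; first by rewrite mem_iota1; lia.
have := @alt_odd i./2.-1.
have -> : (2 * i./2.-1).+2 = i by lia.
have -> : (2 * i./2.-1).+1 = i.-1 by lia.
by rewrite -leqNgt => lt_i; apply/ltnW/lt_i; lia.
Qed.

(** The last letter is the only one at an even position that is not a valley,
    because the boundary letter after it is 0. *)
Lemma ValE : 0 < n ->
  \sum_(v <- Val s) v + L (2 * n) = \sum_(i <- iota 1 (2 * n) | ~~ odd i) L i.
Proof.
move=> n0; rewrite big_map big_filter.
have -> : iota 1 (2 * n) = iota 1 (2 * n).-1 ++ [:: 2 * n].
  have {1}-> : 2 * n = (2 * n).-1 + 1 by lia.
  by rewrite iotaD; congr (_ ++ [:: _]); lia.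
rewrite !big_cat !big_cons !big_nil letter_last ltn0 andbF oddM /= !addn0.
congr (_ + _).
rewrite big_seq_cond [RHS]big_seq_cond; apply: eq_bigl => i.
have [|//] := boolP (i \in _); rewrite mem_iota1 => i_n /=.
have [i_odd|i_even] := boolP (odd i).
  have := @alt_odd i./2.
  have -> : (2 * i./2).+2 = i.+1 by lia.
  have -> : (2 * i./2).+1 = i by lia.
  by move=> ?; lia.
have := @alt_odd i./2.-1; have := @alt_even i./2.-1.
have -> : (2 * i./2.-1).+2 = i by lia.

have -> : (2 * i./2.-1).+1 = i.-1 by lia.
by move=> ? ?; lia.
Qed.

(** The letter 2n is a peak that D leaves out and the last letter is not a
    valley: the terms 2n and - L (2n) of the exponent compensate for both. *)
Lemma hexp_pairs : `|hexp s|%N = area (2 * n) (pairs s).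
Proof.
have -> : area (2 * n) (pairs s)
    = \sum_(0 <= i < n) (minn (L (2 * i).+1) (2 * n) - L (2 * i).+2).
  by rewrite /area big_map /index_iota subn0.
have [n0|n0] := posnP n.
  rewrite /hexp /D /Pk /Val; move: s alt; rewrite n0 => s' _.
  by rewrite !big_nil.
have N_Pk : 2 * n \in Pk s.
  have : 2 * n \in iota 1 (2 * n) by rewrite mem_iota1; lia.
  rewrite -(perm_mem (perm_map_letter s)) PkE => /mapP[i i_in LiE].
  apply/mapP; exists i => //; rewrite mem_filter i_in andbT.
  rewrite mem_iota1 in i_in; have [//|i_even] := boolP (odd i).
  have := @alt_odd i./2.-1; have := @letter_range s i.-1.
  have -> : (2 * i./2.-1).+2 = i by lia.
  have -> : (2 * i./2.-1).+1 = i.-1 by lia.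
  by lia.
have Pk_uniq : uniq (Pk s).
  rewrite map_inj_in_uniq ?filter_uniq ?iota_uniq // => i j.
  by rewrite !mem_filter => /andP[_ +] /andP[_ +]; apply: letter_inj.
have sumPk : \sum_(v <- Pk s) v = 2 * n + \sum_(v <- Pk s | v != 2 * n) v.
  by rewrite (bigD1_seq _ N_Pk Pk_uniq).
have sumVal := ValE n0.
have sumArea : \sum_(0 <= i < n) (minn (L (2 * i).+1) (2 * n) - L (2 * i).+2)
    + \sum_(i <- iota 1 (2 * n) | ~~ odd i) L i = \sum_(v <- Pk s) v.
  rewrite PkE big_map big_filter [X in _ + X]big_mkcond [RHS]big_mkcond /=.
  have -> : iota 1 (2 * n) = index_iota 1 (2 * n).+1 by rewrite /index_iota subn1.
  rewrite !sum_pairs -big_split; apply: eq_big_nat => i i_n /=.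
  have := @alt_odd i; have := @letter_range s (2 * i).+1.
  by rewrite oddM /=; lia.
rewrite /hexp /D; move: sumPk sumVal sumArea.
move: (\sum_(v <- Pk s) v) (\sum_(v <- Pk s | v != 2 * n) v).
move: (\sum_(0 <= i < n) _) (\sum_(i <- iota 1 (2 * n) | ~~ odd i) L i).
move: (\sum_(v <- Val s) v) (L (2 * n)).
by lia.
Qed.

End Alternating.
End Pairs.

(** * Expansion as walks with nonnegative weights *)

Section Expansion.
Local Open Scope ring_scope.
Variables (A : comNzRingType) (x f h alpha p q : A).

(** f and alpha occur with the same exponent because every left-to-right maximum
    of an alternating permutation is a peak. *)
Lemma Ze_walk n :
  Ze n x f h alpha p q
  = walk (up x h p q) (down (f * alpha) h p q) (2 * n) 0.
Proof.
pose oo := (2 * n).+1.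
rewrite -(total_walk x (f * alpha) h p q (oo := oo)) // /total.
transitivity (\sum_(w <- [seq w <- configs oo (2 * n) | holes oo w == 0%N])
   weight x (f * alpha) h p q oo (2 * n) w); last first.
  rewrite big_filter big_mkcond; apply: eq_bigr => w _.
  by case: ifP; rewrite ?mul1r ?mul0r.
pose alts := enum [pred s : 'S_(2 * n) | alternating s].
rewrite [RHS](perm_big [seq pairs s | s <- alts]); last first.
  rewrite perm_sym; apply: uniq_perm.
  - by rewrite map_inj_uniq ?enum_uniq //; apply: pairs_inj.
  - by rewrite filter_uniq // configs_uniq.
  move=> w; rewrite mem_filter mem_configs //.
  apply/mapP/andP => [[s + ->]|[/eqP w0 w_val]].
    by rewrite mem_enum => alt; rewrite holes_pairs valid_pairs.
  by have [s alt ->] := valid_is_pairs w_val w0; exists s; rewrite ?mem_enum.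
rewrite big_map big_enum; apply: eq_bigr => s alt.
rewrite /weight des_pairs // lmaxpk_lmax // records_pairs // hexp_pairs //.
by rewrite pat_31_2_pairs // pat_2_31_pairs // exprMn; ring.
Qed.
End Expansion.

Section Coefficients.
Local Open Scope ring_scope.
Variables (R : realFieldType) (k : nat).
Implicit Types P Q : {mpoly R[k]}.

Lemma coef_ge0_0 : mpoly_coef_ge0 (0 : {mpoly R[k]}).
Proof. by move=> m; rewrite mcoeff0. Qed.

Lemma coef_ge0_1 : mpoly_coef_ge0 (1 : {mpoly R[k]}).
Proof. by move=> m; rewrite mcoeff1 ler0n. Qed.

Lemma coef_ge0_X i : mpoly_coef_ge0 ('X_i : {mpoly R[k]}).
Proof. by move=> m; rewrite mcoeffX ler0n. Qed.

Lemma coef_ge0D P Q :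
  mpoly_coef_ge0 P -> mpoly_coef_ge0 Q -> mpoly_coef_ge0 (P + Q).
Proof. by move=> P0 Q0 m; rewrite mcoeffD addr_ge0. Qed.

Lemma coef_ge0M P Q :
  mpoly_coef_ge0 P -> mpoly_coef_ge0 Q -> mpoly_coef_ge0 (P * Q).
Proof.
by move=> P0 Q0 m; rewrite mcoeffM sumr_ge0 // => i _; rewrite mulr_ge0.
Qed.

Lemma coef_ge0_exp P n : mpoly_coef_ge0 P -> mpoly_coef_ge0 (P ^+ n).
Proof.
move=> P0; elim: n => [|n IHn]; first exact: coef_ge0_1.
by rewrite exprS; apply: coef_ge0M.
Qed.

Lemma coef_ge0_sum (I : Type) (r : seq I) (F : I -> {mpoly R[k]}) :
  (forall i, mpoly_coef_ge0 (F i)) -> mpoly_coef_ge0 (\sum_(i <- r) F i).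
Proof.
move=> F0; apply: (big_ind (@mpoly_coef_ge0 R k)) => //.
  exact: coef_ge0_0.
exact: coef_ge0D.
Qed.

End Coefficients.

Local Open Scope ring_scope.

Theorem theorem7p4 (R : realFieldType) :
  let X (i : nat) : {mpoly R[6]} := 'X_(inord i) in
  coefwise_Hankel_TP
    (fun n : nat => Ze n (X 0%N) (X 1%N) (X 2%N) (X 3%N) (X 4%N) (X 5%N)).
Proof.
move=> X d r c hr hc.
have X0 i n : mpoly_coef_ge0 (X i ^+ n) by exact/coef_ge0_exp/coef_ge0_X.
have fX0 n : mpoly_coef_ge0 ((X 1%N * X 3%N) ^+ n).
  by apply/coef_ge0_exp/coef_ge0M; apply: coef_ge0_X.
have up0 n : mpoly_coef_ge0 (up (X 0%N) (X 2%N) (X 4%N) (X 5%N) n).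
  apply: coef_ge0M; first by apply: coef_ge0M (X0 _ _) => //; apply: coef_ge0_X.
  by apply: coef_ge0_sum => i; apply: coef_ge0M.
have down0 n : mpoly_coef_ge0 (down (X 1%N * X 3%N) (X 2%N) (X 4%N) (X 5%N) n).
  apply: coef_ge0M => //; apply: coef_ge0_sum => i.
  by do 2![apply: coef_ge0M => //].
have := walk_Hankel_TP (@coef_ge0_0 R 6) (@coef_ge0_1 R 6) (@coef_ge0D R 6)
  (@coef_ge0M R 6) up0 down0 hr hc.
move=> /(_ (\max_(j < d) (c j).+1)%N) H.
rewrite (_ : \matrix_(i, j) _ = \matrix_(i < d, j < d)
   walk (up (X 0%N) (X 2%N) (X 4%N) (X 5%N))
     (down (X 1%N * X 3%N) (X 2%N) (X 4%N) (X 5%N)) (2 * (r i + c j)) 0).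
  by apply: H => j; apply: (leq_bigmax (F := fun j => (c j).+1) j).
by apply/matrixP=> i j; rewrite !mxE Ze_walk.
Qed.
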